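(* Let $r,c$ be odd positive integers. The number $a(r,c)$ of near-perfect matchings of the $r\times c$ grid graph is odd if and only if both $r$ and $c$ are congruent to $1$ mod $4$ and $\gcd(r+1,c+1)=2$.
   Context: The $r\times c$ grid graph has vertex set $\{1,\dots,r\}\times\{1,\dots,c\}$, with two vertices adjacent when they differ by $1$ in exactly one coordinate. A near-perfect matching is a set of pairwise disjoint edges covering all vertices but one. *)

(* Defs.v *)
From mathcomp Require Import all_boot.

Set Implicit Arguments.
Unset Strict Implicit.
Unset Printing Implicit Defensive.

(* A simple graph is given by its adjacency relation [e] (symmetric and
   irreflexive) on a finite vertex type; an edge is a two-element vertex set. *)
Definition edge_set (T : finType) (e : rel T) : {set {set T}} :=
  [set E | [exists x, exists y, e x y && (E == [set x; y])]].

Definition near_perfect_matching (T : finType) (e : rel T)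
    (M : {set {set T}}) : bool :=
  [&& M \subset edge_set e, trivIset M & #|~: cover M| == 1].

Definition num_near_perfect_matchings (T : finType) (e : rel T) : nat :=
  #|[set M : {set {set T}} | near_perfect_matching e M]|.

Definition differ_by_one (i j : nat) : bool := (i.+1 == j) || (j.+1 == i).

(* Coordinates are numbered from 0 instead of from 1. *)
Definition grid_adj (r c : nat) : rel ('I_r * 'I_c) :=
  fun u v => (differ_by_one u.1 v.1 && (u.2 == v.2))
          || ((u.1 == v.1) && differ_by_one u.2 v.2).

Lemma grid_adj_sym r c : symmetric (@grid_adj r c).
Proof.
move=> u v; rewrite /grid_adj /differ_by_one (eq_sym v.1) (eq_sym v.2).
by rewrite (orbC (v.1.+1 == _)) (orbC (v.2.+1 == _)).
Qed.

Lemma grid_adj_irr r c : irreflexive (@grid_adj r c).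
Proof.
by move=> u; rewrite /grid_adj /differ_by_one !eqxx !orbb !gtn_eqF.
Qed.

Definition grid_count (r c : nat) : nat :=
  num_near_perfect_matchings (@grid_adj r c).

(* Main.v *)
(* Over the field [bool] = F_2, [\det M] counts, for a symmetric [M] with zero
   diagonal, the fixed-point-free involutions along nonzero entries, since a
   permutation and its inverse cancel.  Adding to a graph with adjacency matrix
   A an apex joined to every vertex turns near-perfect matchings into perfect
   ones, so their number is odd iff the bordered matrix [[A, 1], [1, 0]] is
   invertible, i.e. iff A f = t 1 and sum f = 0 force f = 0 and t = 0.

   For the grid with r, c odd, the indicator f0 of the cells with both
   (1-based) coordinates odd lies in ker A and has sum ((r+1)/2) ((c+1)/2); so
   r = c = 1 mod 4 is necessary.  If g = gcd(r+1, c+1) > 2, the function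
   [2g | i+j] + [i = j mod 2g] is a second element of ker A, and some
   combination with f0 has sum 0.  Conversely, extend f in ker A by reflection
   to a harmonic function F vanishing on the axes.  Then F is symmetric, so
   F(1, -) has both periods 2(r+1) and 2(c+1); for g = 2 it has period 4, which
   forces f to be a multiple of f0; and A f = 1 is excluded by pairing with f0,
   as A is symmetric and f0 has sum 1. *)

Require Import Defs.
From mathcomp Require Import all_boot all_algebra all_fingroup.
From mathcomp Require Import zify.

Set Implicit Arguments.
Unset Strict Implicit.
Unset Printing Implicit Defensive.

Import GRing.Theory.

(** * Near-perfect matchings and the kernel of the adjacency matrix *)

Lemma odd_card_invol (T : finType) (S : {set T}) (f : T -> T) :
  involutive f -> {in S, forall x, f x \in S} ->
  odd #|S| = odd #|[set x in S | f x == x]|.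
Proof.
move=> fK fS.
rewrite -(cardsID [set x | f x == x] S) oddD.
have -> : S :&: [set x | f x == x] = [set x in S | f x == x].
  by apply/setP=> x; rewrite !inE.
set D := S :\: _.
(* [L] keeps from each moved pair x, f x the element of smaller rank, so [f] exchanges the two
   halves of [D]. *)
pose L := [set x | enum_rank x < enum_rank (f x)].
have imL : f @: (D :&: L) = D :\: L.
  apply/setP=> y; apply/imsetP/idP => [[x]|].
    rewrite !inE => /andP[/andP[fx xS] lt] ->.
    by rewrite fK fS // (eq_sym x) fx -leqNgt ltnW.
  rewrite !inE => /and3P[nlt fy yS]; exists (f y); rewrite ?fK //.
  rewrite !inE fK fS // (eq_sym y) fy /=.
  have: enum_rank (f y) != enum_rank y by rewrite (inj_eq enum_rank_inj).
  by move: nlt; rewrite -val_eqE /=; lia.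
rewrite -[in RHS](addbF (odd _)) -(cardsID L D) -imL card_imset ?oddD ?addbb //.
exact: inv_inj.
Qed.

Local Open Scope ring_scope.

Lemma addb0_eq (a b : bool) : a + b = 0 -> b = a.
Proof. by case: a b => [] []. Qed.

Lemma sum_bool_card (T : finType) (P : pred T) :
  \sum_(x : T) P x = odd #|[set x | P x]| :> bool.
Proof.
rewrite -sum1dep_card (@big_morph bool nat odd 0 +%R 0%N addn oddD erefl).
rewrite [RHS]big_mkcond /=.
by apply: eq_bigr => x _; case: (P x).
Qed.

Lemma prod_bool (T : finType) (P : pred T) :
  \prod_(x : T) P x = [forall x, P x] :> bool.
Proof.
have [/forallP allP | /forallPn[x /negPf notP]] := boolP [forall x, P x].
  by rewrite big1 // => x _; rewrite allP.
by rewrite (bigD1 x) //= notP mul0r.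
Qed.

(** Signs are trivial in characteristic 2, so the determinant counts mod 2 the permutations
    supported on [A]. Symmetry of [A] lets inversion act on them, and only its fixed points, the
    involutions, survive. *)
Lemma det_sym_bool n (A : 'M[bool]_n) :
  (forall i j, A i j = A j i) -> (forall i, A i i = false) ->
  \det A = odd #|[set s : 'S_n | [forall i, (s (s i) == i) && A i (s i)]]|.
Proof.
move=> Asym Airr; rewrite /determinant.
have -> : \sum_(s : 'S_n) (-1) ^+ s * \prod_i A i (s i) =
          \sum_(s : 'S_n) [forall i, A i (s i)] :> bool.
  apply: eq_bigr => s _; rewrite prod_bool.
  by have -> : (-1) ^+ s = 1 :> bool by case: (odd_perm s).
rewrite sum_bool_card (odd_card_invol (f := fun s : 'S_n => (s^-1)%g)).
- congr (odd #|pred_of_set _|); apply/setP=> s; rewrite !inE.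
  apply/andP/forallP => [[/forallP sA /eqP sV] i|sA].
    by rewrite sA andbT -{1}sV permK.
  split; first by apply/forallP=> i; case/andP: (sA i).
  apply/eqP/permP=> i; apply: (@perm_inj _ s); rewrite permKV.
  by case/andP: (sA i) => /eqP.
- exact: invgK.
- move=> s; rewrite !inE => /forallP sA; apply/forallP=> i.
  by rewrite Asym -{2}(permKV s i) sA.
Qed.

Lemma set2_inj (T : finType) (x y x' y' : T) : [set x; y] = [set x'; y'] ->
  (x = x' /\ y = y') \/ (x = y' /\ y = x').
Proof.
move=> E.
have: x \in [set x'; y'] by rewrite -E set21.
have: y \in [set x'; y'] by rewrite -E set22.
have: x' \in [set x; y] by rewrite E set21.
have: y' \in [set x; y] by rewrite E set22.
by rewrite !inE; do 4!(case/pred2P=> ?); subst; auto.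
Qed.

(** * Perfect matchings of the cone over a graph *)

Section Cone.

Variables (T : finType) (e : rel T).
Hypotheses (e_sym : symmetric e) (e_irr : irreflexive e).

Definition cone_adj (u v : option T) : bool :=
  match u, v with
  | Some x, Some y => e x y
  | None, None => false
  | _, _ => true
  end.

Let n := #|{: option T}|.

Definition cone_mx : 'M[bool]_n :=
  \matrix_(i, j) cone_adj (enum_val i) (enum_val j).

Definition cone_invols : {set 'S_n} :=
  [set s : 'S_n | [forall i, (s (s i) == i) && cone_mx i (s i)]].

Definition act_opt (s : 'S_n) (u : option T) : option T :=
  enum_val (s (enum_rank u)).

(** Pairs range over [T] only, so the edge at the apex [None] is dropped and its other end becomes
    the uncovered vertex. *)
Definition invol_edges (s : 'S_n) : {set {set T}} :=
  [set [set p.1; p.2] | p in [set p : T * T | act_opt s (Some p.1) == Some p.2]].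

Lemma cone_involsP (s : 'S_n) : reflect
  (forall u, act_opt s (act_opt s u) = u /\ cone_adj u (act_opt s u))
  (s \in cone_invols).
Proof.
rewrite inE; apply: (iffP forallP) => [sP u | sP i].
  have /andP[/eqP sK] := sP (enum_rank u).
  by rewrite /act_opt enum_valK sK enum_rankK mxE enum_rankK.
have [] := sP (enum_val i); rewrite /act_opt !enum_valK mxE => sK ->.
by rewrite andbT; apply/eqP/enum_val_inj.
Qed.

Lemma mem_invol_edges (s : 'S_n) x y : s \in cone_invols ->
  ([set x; y] \in invol_edges s) = (act_opt s (Some x) == Some y).
Proof.
move/cone_involsP=> sP.
apply/imsetP/idP => [[[x' y']]|sxy]; last by exists (x, y); rewrite ?inE.
rewrite inE /= => /eqP sxy' eqE.
have ne : x' != y'.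
  have [_] := sP (Some x'); rewrite sxy' /=.
  by apply: contraTneq => ->; rewrite e_irr.
have syx' : act_opt s (Some y') = Some x' by rewrite -sxy' (sP _).1.
by case: (set2_inj eqE) => [] [-> ->]; rewrite ?sxy' ?syx'.
Qed.

(** The edges fix [s] at every vertex not sent to the apex, hence on all of [T]; the value at the
    apex follows since [s] is an involution. *)
Lemma invol_edges_inj : {in cone_invols &, injective invol_edges}.
Proof.
move=> s s' sI s'I eqM.
have eqS x y : (act_opt s (Some x) == Some y) = (act_opt s' (Some x) == Some y).
  by rewrite -!mem_invol_edges // eqM.
have eqSome x : act_opt s (Some x) = act_opt s' (Some x).
  case E: (act_opt s (Some x)) => [y|].
    by apply/esym/eqP; rewrite -eqS E.
  by case E': (act_opt s' (Some x)) => [y|] //; move: (eqS x y); rewrite E E' eqxx.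
have eqU u : act_opt s u = act_opt s' u.
  case: u => [//|].
  have [sK] := (cone_involsP _ sI) None; case E: (act_opt s None) => [v|] // _.
  by rewrite E eqSome in sK; rewrite -sK ((cone_involsP _ s'I) _).1.
apply/permP=> i; apply: enum_val_inj.
by have := eqU (enum_val i); rewrite /act_opt enum_valK.
Qed.

Lemma invol_edges_matching s : s \in cone_invols ->
  near_perfect_matching e (invol_edges s).
Proof.
move=> sI; have sP := cone_involsP _ sI.
have sS x y : act_opt s (Some x) = Some y -> act_opt s (Some y) = Some x.
  by move=> <-; rewrite (sP _).1.
have [w sw] : exists w, act_opt s None = Some w.
  by have [_] := sP None; case: (act_opt s None) => // w _; exists w.
apply/and3P; split.
- apply/subsetP=> E /imsetP[[x y]]; rewrite inE /= => /eqP sxy ->.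
  rewrite inE; apply/existsP; exists x; apply/existsP; exists y.
  by have [_] := sP (Some x); rewrite sxy eqxx andbT.
- apply/trivIsetP=> E E' /imsetP[[x y]]; rewrite inE /= => /eqP sxy ->.
  move=> /imsetP[[x' y']]; rewrite inE /= => /eqP sxy' ->.
  have syx := sS _ _ sxy; have syx' := sS _ _ sxy'.
  apply: contraR => /pred0Pn[z]; rewrite !inE.
  case/andP=> /pred2P zE /pred2P zE'.
  case: zE zE' => -> [] E1; subst.
  + by move: sxy'; rewrite sxy => -[->].
  + by move: syx'; rewrite sxy => -[->]; rewrite setUC.
  + by move: sxy'; rewrite syx => -[->]; rewrite setUC.
  + by move: syx'; rewrite syx => -[->].
- apply/cards1P; exists w; apply/setP=> x; rewrite !inE; apply/idP/idP.
    case E: (act_opt s (Some x)) => [y|].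
      case/negP; apply/bigcupP; exists [set x; y]; rewrite ?set21 //.
      by rewrite mem_invol_edges ?E.
    by have := (sP (Some x)).1; rewrite E sw => -[->].
  move/eqP->; apply/bigcupP=> -[E /imsetP[[x' y']]].
  rewrite inE /= => /eqP sxy ->; rewrite !inE.
  have sw' : act_opt s (Some w) = None by rewrite -sw (sP _).1.
  by case/pred2P => E1; move: sw'; rewrite E1 ?sxy ?(sS _ _ sxy).
Qed.

(** Inverse of [invol_edges]: a failed [pick] returns [None], which is the apex, the right partner
    of the uncovered vertex. *)
Definition partner (M : {set {set T}}) (u : option T) : option T :=
  if u is Some x then [pick y | [set x; y] \in M] else [pick y in ~: cover M].

Lemma matching_invol M : near_perfect_matching e M ->
  exists2 s, s \in cone_invols & M = invol_edges s.
Proof.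
case/and3P=> /subsetP Me /trivIsetP Mt /cards1P[w covM].
have MeP x y : [set x; y] \in M -> e x y.
  move/Me; rewrite inE => /existsP[x' /existsP[y' /andP[exy /eqP]]].
  by case/set2_inj=> [] [-> ->] //; rewrite e_sym.
have Muniq x y y' : [set x; y] \in M -> [set x; y'] \in M -> y = y'.
  move=> M1 M2; have [E|/(Mt _ _ M1 M2)] := eqVneq [set x; y] [set x; y'].
    by case: (set2_inj E) => [[]|[]] // -> .
  by move/pred0P/(_ x); rewrite /= !set21.
have Mpart x y : [set x; y] \in M -> partner M (Some x) = Some y.
  move=> xyM; rewrite /partner; case: pickP => [y' /Muniq/(_ xyM)->|/(_ y)] //.
  by rewrite xyM.
have coverP x : reflect (exists y, [set x; y] \in M) (x != w).
  have -> : (x != w) = (x \in cover M).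
    by move/setP/(_ x): covM; rewrite !inE => <-; rewrite negbK.
  apply: (iffP bigcupP) => [[E EM xE]|[y xyM]]; last first.
    by exists [set x; y]; rewrite ?set21.
  move: (EM) => /Me; rewrite inE => /existsP[x' /existsP[y' /andP[_ /eqP EE]]].
  subst E; move: xE; rewrite !inE => /pred2P[]->; first by exists y'.
  by exists x'; rewrite setUC.
have pw : partner M (Some w) = None.
  rewrite /partner; case: pickP => // y wyM.
  by have /coverP/eqP : exists y, [set w; y] \in M by exists y.
have pN : partner M None = Some w.
  rewrite /partner covM; case: pickP => [y|/(_ w)]; rewrite inE ?eqxx //.
  by move/eqP->.
have pP u : partner M (partner M u) = u /\ cone_adj u (partner M u).
  case: u => [x|]; last by rewrite pN pw.
  have [->|/coverP[y xyM]] := eqVneq x w; first by rewrite pw pN.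
  by rewrite (Mpart _ _ xyM) (Mpart y x) 1?setUC //; split=> //; exact: MeP.
pose f (i : 'I_n) : 'I_n := enum_rank (partner M (enum_val i)).
have fK : involutive f by move=> i; rewrite /f enum_rankK (pP _).1 enum_valK.
pose s := perm (inv_inj fK).
have sE u : act_opt s u = partner M u.
  by rewrite /act_opt permE /f !enum_rankK.
have sI : s \in cone_invols.
  by apply/cone_involsP=> u; rewrite !sE.
exists s => //; apply/setP=> E; apply/idP/imsetP => [EM|].
  move: (EM) => /Me; rewrite inE => /existsP[x /existsP[y /andP[_ /eqP EE]]].
  by exists (x, y); rewrite // inE /= sE (Mpart x y) -?EE.
case=> [[x y]]; rewrite inE sE /= => /eqP + ->.
by case: pickP => // y' xyM [<-].
Qed.

Lemma odd_near_perfect_det :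
  odd (num_near_perfect_matchings e) = \det cone_mx.
Proof.
rewrite det_sym_bool => [|i j|i].
- rewrite -/cone_invols -(card_in_imset invol_edges_inj).
  congr (odd #|pred_of_set _|); apply/setP=> M; rewrite inE.
  apply/idP/imsetP => [/matching_invol[s]|[s /invol_edges_matching sM ->] //].
  by exists s.
- by rewrite !mxE; case: (enum_val i) (enum_val j) => [x|] [y|] //=; rewrite e_sym.
- by rewrite mxE; case: (enum_val i) => //= x; rewrite e_irr.
Qed.

(** A kernel vector of [cone_mx] is [f] on the vertices with [t] at the apex. In characteristic 2
    the equation at a vertex reads A f = t, and the one at the apex says that [f] sums to 0. *)
Lemma odd_near_perfectP : reflect
  (forall (f : T -> bool) (t : bool),
    (forall x, \sum_y (e y x && f y) = t) -> \sum_y f y = false ->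
    t = false /\ forall x, f x = false)
  (odd (num_near_perfect_matchings e)).
Proof.
have big_opt (F : option T -> bool) : \sum_u F u = F None + \sum_x F (Some x).
  rewrite (bigD1 None) //=; congr (_ + _).
  rewrite (reindex_omap Some id) => [|[]] //=.
  by apply: eq_bigl => x; rewrite eqxx.
have mulE (v : 'rV_n) u : (v *m cone_mx) 0 (enum_rank u) =
    \sum_u' (v 0 (enum_rank u') && cone_adj u' u).
  rewrite mxE (reindex_onto enum_rank enum_val) => [|i _]; last exact: enum_valK.
  rewrite (eq_bigl xpredT) => [|u']; last by rewrite enum_rankK eqxx.
  by apply: eq_bigr => u' _; rewrite mxE !enum_rankK.
rewrite odd_near_perfect_det; apply: (iffP idP) => [dN0 f t ft f0|ker].
  pose v : 'rV_n := \row_i (if enum_val i is Some x then f x else t).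
  have vM : v *m cone_mx = 0.
    apply/rowP=> i; rewrite -(enum_valK i) mulE mxE big_opt.
    case: (enum_val i) => [x|] /=.
      rewrite mxE enum_rankK andbT -(ft x) -[RHS](addbb (\sum_y (e y x && f y))).
      congr (_ (+) _); apply: eq_bigr => y _.
      by rewrite mxE enum_rankK andbC.
    rewrite andbF add0r -[RHS]f0; apply: eq_bigr => y _.
    by rewrite mxE enum_rankK andbT.
  have v0 : v = 0.
    apply/eqP; apply: contraTT dN0 => vN0.
    by rewrite (_ : \det _ = false :> bool) //; apply/eqP/det0P; exists v.
  split=> [|x].
    by move/rowP/(_ (enum_rank None)): v0; rewrite !mxE enum_rankK.
  by move/rowP/(_ (enum_rank (Some x))): v0; rewrite !mxE enum_rankK.
case: (boolP (\det cone_mx == 0)) => [/det0P[v vN0 vM]|]; last by case: (\det _).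
case/eqP: vN0; apply/rowP=> i; rewrite mxE.
have [|| t0 f0] := ker (fun x => v 0 (enum_rank (Some x))) (v 0 (enum_rank None)).
- move=> x; have /rowP/(_ (enum_rank (Some x))) := vM.
  rewrite mulE big_opt mxE /= andbT => /addb0_eq <-.
  by apply: eq_bigr => y _; rewrite andbC.
- have /rowP/(_ (enum_rank None)) := vM.
  rewrite mulE big_opt mxE /= andbF add0r => sum0; rewrite -[RHS]sum0.
  by apply: eq_bigr => y _; rewrite andbT.
- by rewrite -(enum_valK i); case: (enum_val i) => [x|]; rewrite ?t0 ?f0.
Qed.

End Cone.

Local Close Scope ring_scope.

(** * Harmonic functions on the grid over F_2 *)

Lemma andb_mulr (a b : bool) : a && b = (a * b)%R.
Proof. by []. Qed.

(* Centred at [(i.+1, j.+1)]: the cell [(i, j)] of the 0-based grid, with the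
   coordinates [0], [r.+1] and [c.+1] left for the border. *)
Definition nbr_sum (F : nat -> nat -> bool) (i j : nat) : bool :=
  F i j.+1 (+) F i.+2 j.+1 (+) F i.+1 j (+) F i.+1 j.+2.

Definition vanishes_on_border (r c : nat) (F : nat -> nat -> bool) : Prop :=
  forall k, [/\ F 0 k = false, F r.+1 k = false, F k 0 = false & F k c.+1 = false].

Section Grid.

Variables r c : nat.
Implicit Types (f : 'I_r * 'I_c -> bool) (F : nat -> nat -> bool).

(** At most one term is nonzero. Written as a sum, four neighbour values merge termwise into the sum
    over [grid_adj]. *)
Definition zero_ext f (i j : nat) : bool :=
  (\sum_(u : 'I_r * 'I_c) [&& u.1.+1 == i, u.2.+1 == j & f u])%R.

Lemma zero_ext_border f : vanishes_on_border r c (zero_ext f).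
Proof.
move=> k; split; apply: big1 => -[x y] _ //=.
- by rewrite eqSS ltn_eqF.
- by rewrite andbF.
- by rewrite eqSS (ltn_eqF (ltn_ord y)) andbF.
Qed.

Lemma zero_ext_in f (u : 'I_r * 'I_c) : zero_ext f u.1.+1 u.2.+1 = f u.
Proof.
rewrite /zero_ext (bigD1 u) //= !eqxx big1 ?addr0 // => -[x y].
rewrite -pair_eqE /= !eqSS /pair_eq /= !val_eqE andbA.
by move=> /negPf->.
Qed.

Lemma zero_ext_restr F i j : vanishes_on_border r c F ->
  i <= r.+1 -> j <= c.+1 ->
  zero_ext (fun u : 'I_r * 'I_c => F u.1.+1 u.2.+1) i j = F i j.
Proof.
move=> bF ir jc.
(* The border conditions are taken at the coordinate running along the side: [j] where [i] is
   extreme, [i] otherwise. *)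
have [F0 Fr G0 Gc] := bF (if (i == 0) || (i == r.+1) then j else i).
have [E0 Er H0 Hc] := zero_ext_border (fun u : 'I_r * 'I_c => F u.1.+1 u.2.+1)
   (if (i == 0) || (i == r.+1) then j else i).
have [i0|i0] := eqVneq i 0; first by move: E0 F0; rewrite i0 /= => -> ->.
have [i1|i1] := eqVneq i r.+1.
  by move: Er Fr; rewrite i1 /= eqxx => -> ->.
rewrite (negPf i0) (negPf i1) /= in G0 Gc H0 Hc.
have [->|j0] := eqVneq j 0; first by rewrite H0 G0.
have [->|j1] := eqVneq j c.+1; first by rewrite Hc Gc.
have i'r : i.-1 < r by lia.
have j'c : j.-1 < c by lia.
have := zero_ext_in (fun u : 'I_r * 'I_c => F u.1.+1 u.2.+1)
  (Ordinal i'r, Ordinal j'c).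
by rewrite /= !prednK ?lt0n.
Qed.

Lemma grid_adj_sum f (v : 'I_r * 'I_c) :
  (\sum_u (grid_adj u v && f u))%R = nbr_sum (zero_ext f) v.1 v.2.
Proof.
rewrite /nbr_sum /zero_ext -![addb _ _]/(_ + _)%R -!big_split /=.
apply: eq_bigr => -[x y] _; case: v => x' y'.
rewrite /grid_adj /differ_by_one /= -!val_eqE /=.
case: (f _); rewrite ?andbF ?andbT //.
rewrite -![GRing.add _ _]/(addb _ _) !eqSS (eq_sym x'.+1) (eq_sym y'.+1).
have [->|xx] := eqVneq (x : nat) x'; have [->|yy] := eqVneq (y : nat) y' => /=.
- by rewrite ?(gtn_eqF (ltnSn _)) ?(ltn_eqF (ltnSn _)).
- rewrite ?(gtn_eqF (ltnSn _)) ?(ltn_eqF (ltnSn _)) /=.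
  by case: eqP; case: eqP => //=; lia.
- rewrite ?(gtn_eqF (ltnSn _)) ?(ltn_eqF (ltnSn _)) /= ?andbT ?andbF ?orbF.
  by case: eqP; case: eqP => //=; lia.
- by rewrite !andbF.
Qed.

(* [u] is 0-based, so these are the cells with odd 1-based coordinates. *)
Definition odd_cells (u : 'I_r * 'I_c) : bool := ~~ odd u.1 && ~~ odd u.2.

Lemma sum_odd_cells :
  (\sum_u odd_cells u)%R = odd (uphalf r) && odd (uphalf c).
Proof.
have sumE n : (\sum_(i < n) ~~ odd i)%R = odd (uphalf n).
  elim: n => [|n IH]; first by rewrite big_ord0.
  rewrite big_ord_recr /= IH uphalf_half -[GRing.add _ _]/(addb _ _).
  by rewrite oddD oddb; case: (odd n); case: (odd _).
rewrite -!sumE [RHS]andb_mulr big_distrlr /= pair_big /=.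
by apply: eq_bigr.
Qed.

Lemma odd_cells_nbr_sum v : odd r -> odd c ->
  (\sum_u (grid_adj u v && odd_cells u))%R = false.
Proof.
move=> hr hc.
pose F i j := odd i && odd j && (i <= r) && (j <= c).
have bF : vanishes_on_border r c F.
  by move=> k; rewrite /F /= !ltnn hr hc /= !andbF.
rewrite (eq_bigr (fun u => grid_adj u v && F u.1.+1 u.2.+1)) => [|[x y] _].
  rewrite (grid_adj_sum (fun u : 'I_r * 'I_c => F u.1.+1 u.2.+1)) /nbr_sum.
  case: v => x y /=; have := ltn_ord x; have := ltn_ord y => ltx lty.
  rewrite !(zero_ext_restr bF) ?ltnS ?(ltnW ltx) ?(ltnW lty)
    ?(leqW (ltnW ltx)) ?(leqW (ltnW lty)) //.
  (* For odd [x] the 1-based centre [x.+1] is even; as [r] is odd, its far neighbour [x.+2] stays in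
     the grid, so contributions cancel in pairs. *)
  have x2 : odd x -> x.+1 < r by lia.
  have y2 : odd y -> y.+1 < c by lia.
  rewrite /F /= ltx lty (ltnW ltx) (ltnW lty).
  by case: (odd x) x2 => [->|_] //; case: (odd y) y2 => [->|_].
by rewrite /F /odd_cells /= !ltn_ord !andbT.
Qed.

(** Paired with [odd_cells], this symmetry of the adjacency form later rules out A f = 1. *)
Lemma grid_adj_pairing f g :
  (\sum_x (f x && \sum_y (grid_adj y x && g y)))%R =
  (\sum_y (g y && \sum_x (grid_adj x y && f x)))%R.
Proof.
have E f1 g1 : (\sum_x (f1 x && \sum_y (grid_adj y x && g1 y)))%R =
   (\sum_x \sum_y [&& f1 x, grid_adj y x & g1 y])%R.
  by apply: eq_bigr => x _; rewrite andb_mulr big_distrr.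
rewrite !E exchange_big /=; apply: eq_bigr => y _; apply: eq_bigr => x _.
by rewrite grid_adj_sym; case: (f x); case: (g y); rewrite ?andbF ?andbT.
Qed.

End Grid.

(** * Extension by reflection *)

(* The fold R -> [0, N] generated by the reflections in the multiples of [N]. *)
Definition fold_line (N k : nat) : nat :=
  if odd (k %/ N) then N - k %% N else k %% N.

(** The endpoint [m = N] is allowed: a multiple of [N] may be read as the end of one block or the
    start of the next, and both readings agree. *)
Lemma fold_lineE N q m : 0 < N -> m <= N ->
  fold_line N (q * N + m) = if odd q then N - m else m.
Proof.
move=> N0; rewrite leq_eqVlt => /predU1P[->|mN].
  rewrite /fold_line divnMDl // divnn N0 modnMDl modnn addn1 /= subn0 subnn.
  by case: odd.
by rewrite /fold_line divnMDl // modnMDl divn_small // modn_small // addn0.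
Qed.

Lemma fold_line_small N k : 0 < N -> k <= N -> fold_line N k = k.
Proof. by move=> N0 kN; rewrite -[in LHS](add0n k) -(mul0n N) fold_lineE. Qed.

Lemma fold_line_period N k : 0 < N -> fold_line N (k + 2 * N) = fold_line N k.
Proof.
by move=> N0; rewrite addnC /fold_line divnMDl // modnMDl oddD.
Qed.

Lemma fold_line_nbr N k : 1 < N ->
  let m := fold_line N k.+1 in let a := fold_line N k in
  let b := fold_line N k.+2 in
  (a = b /\ (m = 0 \/ m = N)) \/
  (0 < m < N /\ ((a = m.-1 /\ b = m.+1) \/ (a = m.+1 /\ b = m.-1))).
Proof.
move=> N1; have N0 : 0 < N by lia.
rewrite /= (divn_eq k N); have := ltn_pmod k N0.
move: (k %/ N) (k %% N) => q m mN.
rewrite -!addnS; have [mN2|mN2] := leqP m.+2 N.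
  rewrite !fold_lineE //; [|lia].
  by case: odd; lia.
(* Here [m] is N - 1: the centre lies on a mirror and its successor opens the next block. *)
have -> : q * N + m.+2 = q.+1 * N + 1 by lia.
rewrite !fold_lineE //; last lia.
by rewrite [odd q.+1]/=; case: (odd q) => /=; lia.
Qed.

Section Reflection.

Variables (r c : nat) (G : nat -> nat -> bool).
Hypotheses (r0 : 0 < r) (c0 : 0 < c) (bG : vanishes_on_border r c G).
Hypothesis harmG : forall i j, i < r -> j < c -> nbr_sum G i j = false.

Definition reflect_ext (i j : nat) : bool :=
  G (fold_line r.+1 i) (fold_line c.+1 j).

(** If the centre lies on a mirror, the neighbours along it vanish with [G] and the two across it
    coincide. Off the mirrors, folding only permutes the neighbours of a grid cell. *)
Lemma reflect_ext_harmonic i j : nbr_sum reflect_ext i j = false.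
Proof.
rewrite /nbr_sum /reflect_ext.
have := fold_line_nbr i (N := r.+1) r0; have := fold_line_nbr j (N := c.+1) c0.
rewrite /=; move: (fold_line r.+1 i) (fold_line r.+1 i.+1) (fold_line r.+1 i.+2).
move: (fold_line c.+1 j) (fold_line c.+1 j.+1) (fold_line c.+1 j.+2).
move=> b m b' a n a'.
case=> [[-> mE]|[mE bE]] [[-> nE]|[nE aE]].
- have Gm k : G k m = false by case: mE (bG k) => -> [].
  have Gn k : G n k = false by case: nE (bG k) => -> [].
  by rewrite !Gm !Gn.
- have Gm k : G k m = false by case: mE (bG k) => -> [].
  by rewrite !Gm; case: (G _ _).
- have Gn k : G n k = false by case: nE (bG k) => -> [].
  by rewrite !Gn; case: (G _ _).
- have [n0 nr] := andP nE; have [m0 mc] := andP mE.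
  have n1 : n.-1 < r by rewrite prednK.
  have m1 : m.-1 < c by rewrite prednK.
  have := harmG n1 m1; rewrite /nbr_sum !prednK // => <-.
  case: aE => [] [-> ->]; case: bE => [] [-> ->]; first by [].
  + by rewrite -addbA (addbC (G n _)) addbA.
  + by rewrite (addbC (G n.+1 m)).
  + by rewrite (addbC (G n.+1 m)) -addbA (addbC (G n _)) addbA.
Qed.

End Reflection.

(** * Symmetry and periodicity of harmonic functions *)

Lemma harmonic_symmetric (F : nat -> nat -> bool) :
  (forall k, F 0 k = false) -> (forall k, F k 0 = false) ->
  (forall i j, nbr_sum F i j = false) -> forall i j, F i j = F j i.
Proof.
move=> F0 G0 harm i j; have [n] := ubnP (i + j); elim: n i j => // n IH i j.
rewrite ltnS leq_eqVlt => /predU1P[ijn|]; last exact: IH.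
pose D i j := F i j (+) F j i.
(* Harmonicity makes [D] constant on the interior of the antidiagonal
   [i + j = n], and it vanishes in the middle. *)
suff Dconst i1 j1 : i1.+1 + j1.+1 = n -> D i1.+1 j1.+1 = false.
  case: i j ijn => [|i] [|j] ijn; rewrite ?F0 ?G0 //.
  by have := Dconst _ _ ijn; rewrite /D; do 2!case: (F _ _).
(* Add the equations centred at (k+1, l+1) and (l+1, k+1): the terms on the antidiagonal n - 2
   cancel by induction. *)
have step k l : k + l + 3 = n -> D k.+2 l.+1 = D k.+1 l.+2.
  move=> kln; have := harm k l; have := harm l k; rewrite /nbr_sum /D.
  by rewrite (IH k l.+1) ?(IH k.+1 l); lia.
have down k l : k.+1 + l.+1 = n -> D k.+1 l.+1 = D 1 (k + l).+1.
  elim: k l => // k IHk l kln; rewrite step; last lia.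
  by rewrite IHk ?addSnnS //; lia.
move=> ijn1; rewrite down //.
(* For even [n] the middle lies on the diagonal; for odd [n] the equation centred at (m+1, m+1)
   gives the claim. *)
have [m nE] : exists m, n = m.+1 + m.+1 \/ n = m.+1 + m.+2.
  by exists n./2.-1; lia.
suff [k [l [kln Dkl]]] : exists k l, k.+1 + l.+1 = n /\ D k.+1 l.+1 = false.
  by rewrite -Dkl (down k l) //; congr (D _ _); lia.
case: nE => nE.
  by exists m, m; split; last exact: addbb.
exists m, m.+1; split=> //; have := harm m m; rewrite /nbr_sum /D.
by rewrite (IH m m.+1) //; [do 3!case: (F _ _) | lia].
Qed.

Lemma periodic_gcd (h : nat -> bool) p q : 0 < p ->
  (forall k, h (k + p) = h k) -> (forall k, h (k + q) = h k) ->
  forall k, h (k + gcdn p q) = h k.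
Proof.
move=> p0 hp hq k.
have mulP t : (forall k, h (k + t) = h k) -> forall a k, h (k + a * t) = h k.
  move=> ht a; elim: a => [|a IH] k'; first by rewrite addn0.
  by rewrite mulSn addnA IH ht.
case: (egcdnP q p0) => u v uv _.
(* Bezout in the form u p = v q + gcd: shifting by v q turns the shift by the gcd into one by u
   p. *)
rewrite -(mulP q hq v) -addnA (addnC (gcdn _ _)) -uv; exact: mulP.
Qed.

Lemma odd_cells_kernel r c (f : 'I_r * 'I_c -> bool) :
  r = 1 %[mod 4] -> c = 1 %[mod 4] -> gcdn r.+1 c.+1 = 2 ->
  (forall v, (\sum_u (grid_adj u v && f u))%R = false) ->
  exists a, forall u, f u = a && odd_cells u.
Proof.
move=> r1 c1 grc ker.
have r0 : 0 < r by lia.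
have c0 : 0 < c by lia.
have bG := zero_ext_border f; set G := zero_ext f in bG.
have harmG i j : i < r -> j < c -> nbr_sum G i j = false.
  by move=> ir jc; rewrite -(ker (Ordinal ir, Ordinal jc)) grid_adj_sum.
have harm := reflect_ext_harmonic r0 c0 bG harmG.
pose F := reflect_ext r c G; rewrite -/F in harm.
have F0 k : F 0 k = false.
  by rewrite /F /reflect_ext fold_line_small //; case: (bG (fold_line c.+1 k)).
have G0 k : F k 0 = false.
  rewrite /F /reflect_ext (fold_line_small (N := c.+1)) //.
  by case: (bG (fold_line r.+1 k)).
have symF := harmonic_symmetric F0 G0 harm.
(* By symmetry [F 1] is also a column, so it has both periods 2(r+1) and 2(c+1). *)
have per4 k : F 1 (k + 4) = F 1 k.
  have -> : 4 = gcdn (2 * r.+1) (2 * c.+1) by rewrite -muln_gcdr grc.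
  apply: (periodic_gcd (h := F 1)) => // {}k.
    by rewrite !(symF 1) /F /reflect_ext fold_line_period.
  by rewrite /F /reflect_ext fold_line_period.
have per4n q k : F 1 (q * 4 + k) = F 1 k.
  by elim: q => // q IH; rewrite mulSn -addnA addnC per4.
(* Column [c.+1], where [F] vanishes, is congruent to 2 mod 4. *)
have F12 : F 1 2 = false.
  rewrite -(per4n (c %/ 4)) (_ : _ + 2 = c.+1); last lia.
  rewrite /F /reflect_ext (fold_line_small (N := c.+1)) //.
  by case: (bG (fold_line r.+1 1)).
(* Column 2c+1 is congruent to 3 mod 4 and reflects in the mirror [c.+1] to column 1. *)
have F13 : F 1 3 = F 1 1.
  rewrite -(per4n (c %/ 4 * 2)) (_ : _ + 3 = 1 * c.+1 + c); last lia.
  rewrite /F /reflect_ext fold_lineE //= subSnn.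
  by rewrite (fold_line_small (N := c.+1)).
have fE u : f u = F u.1.+1 u.2.+1.
  case: u => x y; rewrite -(zero_ext_in f) -/G /F /reflect_ext /=.
  by rewrite !fold_line_small // ltnW // ltnS.
clearbody F.
have row1 j : F 1 j = F 1 1 && odd j.
  rewrite (divn_eq j 4) per4n oddD oddM andbF /=.
  have : j %% 4 < 4 by rewrite ltn_mod.
  by case: (j %% 4) => [|[|[|[|]]]] //= _; rewrite ?G0 ?F12 ?F13 ?andbT ?andbF.
(* Harmonicity determines each row from the two before it, so the induction carries a pair of
   rows. *)
have rows i : (forall j, F i j = [&& F 1 1, odd i & odd j]) /\
              (forall j, F i.+1 j = [&& F 1 1, odd i.+1 & odd j]).
  elim: i => [|i [IH0 IH1]]; first by split=> j; rewrite ?F0 ?andbF // row1.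
  split=> // -[|j]; first by rewrite G0 !andbF.
  have := harm i j; rewrite /nbr_sum (IH0 j.+1) (IH1 j) (IH1 j.+2) /=.
  by case: (F i.+2 _) (F 1 1) (odd i) (odd j) => [] [] [] [].
by exists (F 1 1) => u; rewrite fE (rows _).1.
Qed.

(** * A second kernel element when the gcd exceeds 2 *)

Definition diagonal_cells (d i j : nat) : bool :=
  (d %| i + j) (+) (i == j %[mod d]).

(** Any function of i + j alone, or of i - j alone, is harmonic over F_2: its values at the four
    neighbours are equal in pairs. *)
Lemma diagonal_cells_harmonic d i j : nbr_sum (diagonal_cells d) i j = false.
Proof.
rewrite /nbr_sum /diagonal_cells !(addnS, addSn).
have S2 a b : (a.+2 == b.+1 %[mod d]) = (a.+1 == b %[mod d]).
  by rewrite -!(addn1 _.+1) -(addn1 b) eqn_modDr.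
have S2' a b : (a.+1 == b.+2 %[mod d]) = (a == b.+1 %[mod d]).
  by rewrite -(addn1 a) -(addn1 b.+1) eqn_modDr.
by rewrite S2 S2'; do 2!case: (_ %| _); do 2!case: (_ == _).
Qed.

(** When d divides 2N, N and -N agree mod d, so the two indicators coincide on the line at N and
    cancel. *)
Lemma diagonal_cells_border d r c : d %| 2 * r.+1 -> d %| 2 * c.+1 ->
  vanishes_on_border r c (diagonal_cells d).
Proof.
have line N k : d %| 2 * N -> (d %| N + k) = (N == k %[mod d]).
  rewrite -(eqn_modDl N N) addnn -mul2n => /eqP ->.
  by rewrite eq_sym.
move=> dr dc k; rewrite /diagonal_cells.
split.
- by rewrite add0n mod0n eq_sym addbb.
- by rewrite line ?addbb.
- by rewrite addn0 mod0n addbb.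
- by rewrite addnC line // eq_sym addbb.
Qed.

Theorem theorem10 (r c : nat) (hr : odd r) (hc : odd c) :
  odd (grid_count r c) <->
  (r = 1 %[mod 4] /\ c = 1 %[mod 4]) /\ gcdn r.+1 c.+1 = 2.
Proof.
have r0 : 0 < r by case: (r) hr.
have c0 : 0 < c by case: (c) hc.
have sum0 := sum_odd_cells r c.
have harm0 (v : 'I_r * 'I_c) := odd_cells_nbr_sum v hr hc.
split=> [/(odd_near_perfectP (@grid_adj_sym r c) (@grid_adj_irr r c)) inj|].
  (* Otherwise [odd_cells] itself would be a kernel vector of sum 0, nonzero at the corner. *)
  have sum1 : (\sum_u (@odd_cells r c) u)%R = true.
    apply/negbNE/negP => /negbTE s0.
    by have [_ /(_ (Ordinal r0, Ordinal c0))] := inj _ _ harm0 s0.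
  move: (sum1); rewrite sum0 => /andP[r1 c1].
  split; first by split; lia.
  apply/eqP/negPn/negP => g2.
  set g := gcdn _ _ in g2.
  have gr : g %| r.+1 by rewrite dvdn_gcdl.
  have gc : g %| c.+1 by rewrite dvdn_gcdr.
  have g4 : 3 < g.
    have : 2 %| g by rewrite dvdn_gcd; lia.
    have : 0 < g by rewrite gcdn_gt0.
    by lia.
  have c3 : 2 < c by have := dvdn_leq (isT : 0 < c.+1) gc; lia.
  pose f (u : 'I_r * 'I_c) := diagonal_cells (2 * g) u.1.+1 u.2.+1.
  have bF : vanishes_on_border r c (diagonal_cells (2 * g)).
    by apply: diagonal_cells_border; rewrite dvdn_pmul2l.
  have harmf v : (\sum_u (grid_adj u v && f u))%R = false.
    rewrite grid_adj_sum -[RHS](diagonal_cells_harmonic (2 * g) v.1 v.2).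
    case: v => x y; have := ltn_ord x; have := ltn_ord y => /= ltx lty.
    by rewrite /nbr_sum !(zero_ext_restr bF) //; lia.
  (* Since [odd_cells] has sum 1, adding [t] times it brings the sum of [f] to 0. *)
  pose t := (\sum_u f u)%R : bool.
  pose w u := f u (+) (t && odd_cells u).
  have [v||_ w0] := inj w false.
  - rewrite (eq_bigr (fun u => (grid_adj u v && f u : bool) +
      (t && (grid_adj u v && odd_cells u) : bool))%R) => [|u _].
      rewrite big_split /= harmf add0r -[RHS](andbF t) -(harm0 v).
      by rewrite andb_mulr big_distrr.
    by rewrite /w; case: grid_adj; rewrite ?andbF.
  - rewrite big_split /= -/t.
    have -> : (\sum_(u : 'I_r * 'I_c) (t && odd_cells u))%R =
      (t * \sum_(u : 'I_r * 'I_c) odd_cells u)%R.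
      by rewrite big_distrr.
    by rewrite sum1 mulr1; exact: addbb.
  (* The 1-based cells (1,1) and (1,3) are both odd cells, but as 2g is at least 8 [f] is 1 at the
     first and 0 at the second, so [w] cannot vanish at both. *)
  have := w0 (Ordinal r0, Ordinal c0); have := w0 (Ordinal r0, Ordinal c3).
  rewrite /w /f /odd_cells /diagonal_cells /= !andbT.
  by rewrite !gtnNdvd ?(@modn_small 1) ?(@modn_small 3) //; lia.
case=> -[r1 c1] g2.
apply/(odd_near_perfectP (@grid_adj_sym r c) (@grid_adj_irr r c)) => f t ft f0.
have sum1 : (\sum_u (@odd_cells r c) u)%R = true by rewrite sum0; lia.
have t0 : t = false.
  have := grid_adj_pairing (@odd_cells r c) f.
  rewrite [RHS]big1 => [|y _]; last by rewrite harm0 andbF.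
  rewrite (eq_bigr (fun x => odd_cells x * t)%R) => [|x _]; last by rewrite ft.
  by rewrite -big_distrl /= sum1 mul1r.
split=> //.
have [|a fE] := odd_cells_kernel r1 c1 g2 (f := f).
  by move=> v; rewrite ft.
have a0 : a = false.
  rewrite -f0 (eq_bigr (fun u => a * odd_cells u)%R) => [|u _]; last exact: fE.
  by rewrite -big_distrr /= sum1 mulr1.
by move=> u; rewrite fE a0.
Qed.
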